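(* Let $(M_1,g_1)$ and $(M_2,g_2)$ be Riemannian manifolds, $f_i:M_i\to(0,\infty)$ ($i=1,2$) smooth positive functions and $c\in\mathbb{R}$ such that $0\le c^2\, g_1(\mathrm{grad} f_1,\mathrm{grad} f_1)(p_1)\; g_2(\mathrm{grad} f_2,\mathrm{grad} f_2)(p_2)<1$ for all $(p_1,p_2)\in M_1\times M_2$, and let $G_{f_1f_2}$ be the generalized warped product metric on $M_1\times M_2$. Let $(G_{f_1f_2},\nabla,\nabla^{*})$ be a dualistic structure on $M_1\times M_2$. Then for each $i\in\{1,2\}$ there exist affine connections $\overset{i}{\nabla}$, $\overset{i}{\nabla}{}^{*}$ on $M_i$ such that $(g_i,\overset{i}{\nabla},\overset{i}{\nabla}{}^{*})$ is a dualistic structure on $M_i$.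
   Context: Dualistic structure: on a (pseudo-)Riemannian manifold $(M,g)$, two affine connections $\nabla,\nabla^*$ are conjugate with respect to $g$ if $X(g(Y,Z))=g(\nabla_XY,Z)+g(Y,\nabla^*_XZ)$ for all vector fields $X,Y,Z$ on $M$; then $(g,\nabla,\nabla^* )$ is called a dualistic structure on $M$. Lifts: $\pi_i:M_1\times M_2\to M_i$ are the projections. For a function $\varphi$ on $M_1$ (resp. $M_2$), $\varphi^h=\varphi\circ\pi_1$ (resp. $\varphi^v=\varphi\circ\pi_2$). Generalized warped product metric: $$G_{f_1f_2}=(f_2^v)^2\pi_1^*g_1+(f_1^h)^2\pi_2^*g_2+c f_1^hf_2^v\,(df_1^h\otimes df_2^v+df_2^v\otimes df_1^h).$$ Under the stated inequality it is a Riemannian metric on $M_1\times M_2$. The gradient $\mathrm{grad} f_i$ is taken with respect to $g_i$. *)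

(* Defs.v *)
From HB Require Import structures.
From mathcomp Require Import all_boot all_order all_algebra.
From mathcomp Require Import all_classical all_reals all_analysis.

Set Implicit Arguments.
Unset Strict Implicit.
Unset Printing Implicit Defensive.

Import Order.TTheory GRing.Theory Num.Theory numFieldNormedType.Exports.

Local Open Scope classical_set_scope.
Local Open Scope ring_scope.

(* f is of class C^k on the open set U; only the values of f on U matter. *)
Fixpoint Ck_on (R : realType) (V W : normedModType R) (k : nat) (U : set V)
    (f : V -> W) : Prop :=
  match k with
  | 0 => forall x, U x -> {for x, continuous f}
  | k'.+1 => (forall x, U x -> differentiable f x) /\
             (forall v, Ck_on k' U ('D_v f))
  end.

Definition smooth_on (R : realType) (V W : normedModType R) (U : set V)
  (f : V -> W) : Prop := forall k, Ck_on k U f.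

(* Second countable Hausdorff smooth manifold without boundary, of arbitrary
   dimension, nonempty but not necessarily connected, given by an atlas of
   charts [chart i] from the open set [chart_dom i] onto an open subset of
   R^dim, with inverse [param i]. Outside [chart_dom i] and its image, [chart i]
   and [param i] are irrelevant. [chart_at] selects one chart around each point;
   it is only used to fix the components of a tangent vector ([tangent] below). *)
Record manifold (R : realType) := Manifold {
  point :> topologicalType;
  dim : nat;
  chart_index : Type;
  chart_dom : chart_index -> set point;
  chart : chart_index -> point -> 'rV[R]_dim;
  param : chart_index -> 'rV[R]_dim -> point;
  chart_at : point -> chart_index;
  manifold_nonempty : [set: point] !=set0;
  manifold_hausdorff : hausdorff_space point;
  manifold_second_countable : @second_countable point;
  chart_atP : forall p, chart_dom (chart_at p) p;
  chart_dom_open : forall i, open (chart_dom i);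
  chart_img_open : forall i, open (chart i @` chart_dom i);
  chartK : forall i p, chart_dom i p -> param i (chart i p) = p;
  chart_continuous :
    forall i p, chart_dom i p -> {for p, continuous (chart i)};
  param_continuous :
    forall i x, (chart i @` chart_dom i) x -> {for x, continuous (param i)};
  chart_smooth : forall i j,
    smooth_on (chart i @` (chart_dom i `&` chart_dom j)) (chart j \o param i)
}.
Arguments chart_dom {R m}.
Arguments chart {R m}.
Arguments param {R m}.
Arguments chart_at {R m}.
Arguments chart_dom_open {R m}.
Arguments chart_img_open {R m}.
Arguments chart_atP {R m}.


Section Ck_theory.
Context {R : realType}.
Implicit Types V W : normedModType R.

Lemma near_eq_on V W (U : set V) (f g : V -> W) x :
  open U -> (forall y, U y -> f y = g y) -> U x -> \forall y \near x, f y = g y.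
Proof.
by move=> oU fg Ux; apply: filterS fg _; exact: open_nbhs_nbhs.
Qed.

Lemma near_eq_continuous V W (f g : V -> W) x :
  (\forall y \near x, f y = g y) ->
  {for x, continuous f} -> {for x, continuous g}.
Proof.
move=> fg; rewrite /prop_for /continuous_at -(nbhs_singleton fg) => cf.
by apply: cvg_trans cf; apply: near_eq_cvg; apply: filterS fg => y ->.
Qed.

Lemma near_eq_differentiable V W (f g : V -> W) x :
  (\forall y \near x, f y = g y) -> differentiable f x -> differentiable g x.
Proof.
move=> fg df.
have fgx := nbhs_singleton fg.
have [cdf ef] := (diff_locallyP x f).1 df.
have eg : g \o shift x = cst (g x) + 'd f x +o_ 0 id.
  apply/eqaddoP => e e0.
  have /eqaddoP/(_ e e0) := ef.
  have : \forall y \near (0 : V), f (y + x) = g (y + x).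
    by move: fg; rewrite (near_shift 0) /= ?sub0r; apply: filterS => y; rewrite subr0.
  apply: filterS2 => y fgy; congr (`|_| <= _).
  by rewrite /= -[LHS]/(_ - (_ + _)) -[RHS]/(_ - (_ + _)) /= fgy /cst fgx.
by apply/diff_locallyP; rewrite (diff_unique cdf eg).
Qed.

Lemma eq_Ck_on V W k (U : set V) (f g : V -> W) :
  open U -> (forall x, U x -> f x = g x) -> Ck_on k U f -> Ck_on k U g.
Proof.
move=> oU; elim: k f g => [|k IH] f g fg /=.
  by move=> cf x Ux; apply: near_eq_continuous (cf _ Ux); exact: near_eq_on fg _.
move=> [df Df]; split=> [x Ux|v].
  by apply: near_eq_differentiable (df _ Ux); exact: near_eq_on fg _.
apply: IH (Df v) => x Ux; apply: near_eq_derive; exact: near_eq_on fg _.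
Qed.

Lemma Ck_onD V W k (U : set V) (f g : V -> W) :
  open U -> Ck_on k U f -> Ck_on k U g -> Ck_on k U (f + g).
Proof.
move=> oU; elim: k f g => [|k IH] f g /=.
  by move=> cf cg x Ux; apply: continuousD; [exact: cf|exact: cg].
move=> [df Df] [dg Dg]; split=> [x Ux|v].
  by apply: differentiableD; [exact: df|exact: dg].
apply: (eq_Ck_on oU _ (IH _ _ (Df v) (Dg v))) => x Ux.
by rewrite deriveD//; apply: diff_derivable; [exact: df|exact: dg].
Qed.

Lemma Ck_on_compl V W (W' : normedModType R) k (U : set V) (f : V -> W) (L : {linear W -> W'}) :
  open U -> continuous L -> Ck_on k U f -> Ck_on k U (L \o f).
Proof.
move=> oU cL; elim: k f => [|k IH] f /=.
  by move=> cf x Ux; apply: continuous_comp; [exact: cf|exact: cL].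
move=> [df Df]; have dL y : differentiable L y by exact: linear_differentiable.
split=> [x Ux|v].
  by apply: differentiable_comp; [exact: df|].
apply: (eq_Ck_on oU _ (IH _ (Df v))) => x Ux /=.
have dfx := df _ Ux.
rewrite deriveE// deriveE; last exact: differentiable_comp.
by rewrite (diff_comp dfx (dL _)) /= diff_lin.
Qed.

Lemma Ck_on_compr V (V' : normedModType R) W k (U : set V) (f : V -> W) (L : {linear V' -> V}) :
  open U -> continuous L -> Ck_on k U f -> Ck_on k (L @^-1` U) (f \o L).
Proof.
move=> oU cL; have oLU : open (L @^-1` U) by apply: open_comp.
elim: k f => [|k IH] f /=.
  by move=> cf x Ux; apply: continuous_comp; [exact: cL|exact: cf].
move=> [df Df]; have dL y : differentiable L y by exact: linear_differentiable.
split=> [x Ux|v].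
  by apply: differentiable_comp; [|exact: df].
apply: (eq_Ck_on oLU _ (IH _ (Df (L v)))) => x Ux /=.
have dfx := df _ Ux.
rewrite deriveE// deriveE; last exact: differentiable_comp.
by rewrite (diff_comp (dL _) dfx) /= diff_lin.
Qed.

Lemma continuous_row_mx (T : topologicalType) m n1 n2
    (f : T -> 'M[R]_(m, n1)) (g : T -> 'M[R]_(m, n2)) x :
  {for x, continuous f} -> {for x, continuous g} ->
  {for x, continuous (fun y => row_mx (f y) (g y))}.
Proof.
move=> cf cg A [P uP PA].
have xf : \forall y \near x, forall i j, P i (lshift n2 j) (f y i j).
  apply: (cf [set w | forall i j, P i (lshift n2 j) (w i j)]).
  exists (fun i j => P i (lshift n2 j)) => // i j.
  by have := uP i (lshift n2 j); rewrite row_mxEl.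
have xg : \forall y \near x, forall i j, P i (rshift n1 j) (g y i j).
  apply: (cg [set w | forall i j, P i (rshift n1 j) (w i j)]).
  exists (fun i j => P i (rshift n1 j)) => // i j.
  by have := uP i (rshift n1 j); rewrite row_mxEr.
apply: filterS2 xf xg => y yf yg; apply: PA => i j; rewrite mxE.
by case: splitP => k jk;
  [have -> : j = lshift n2 k by exact: val_inj
  |have -> : j = rshift n1 k by exact: val_inj].
Qed.

Lemma Ck_on_sub V W k (U U' : set V) (f : V -> W) :
  U' `<=` U -> Ck_on k U f -> Ck_on k U' f.
Proof.
move=> sU; elim: k f => [|k IH] f /= => [cf x /sU/cf//|[df Df]].
by split=> [x /sU/df//|v]; exact: IH (Df v).
Qed.

Lemma Ck_on_row_mx V k (U : set V) n1 n2 (f : V -> 'rV[R]_n1)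
    (g : V -> 'rV[R]_n2) :
  open U -> Ck_on k U f -> Ck_on k U g ->
  Ck_on k U (fun x => row_mx (f x) (g x)).
Proof.
move=> oU Cf Cg.
pose L1 : {linear 'rV[R]_n1 -> 'rV[R]_(n1 + n2)} := mulmxr (row_mx 1%:M 0).
pose L2 : {linear 'rV[R]_n2 -> 'rV[R]_(n1 + n2)} := mulmxr (row_mx 0 1%:M).
have L1E : L1 = (fun u => row_mx u 0) :> (_ -> _).
  by apply/funext => u; rewrite /L1 /= mul_mx_row mulmx1 mulmx0.
have L2E : L2 = (fun u => row_mx 0 u) :> (_ -> _).
  by apply/funext => u; rewrite /L2 /= mul_mx_row mulmx1 mulmx0.
have -> : (fun x => row_mx (f x) (g x)) = (L1 \o f) + (L2 \o g).
  apply/funext => x; rewrite -[RHS]/(L1 (f x) + L2 (g x)) L1E L2E.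
  by rewrite add_row_mx addr0 add0r.
apply: Ck_onD => //; apply: Ck_on_compl => // u.
- by rewrite L1E; apply: (@continuous_row_mx _ _ _ _ id (cst 0));
    [exact: cvg_id|exact: cst_continuous].
- by rewrite L2E; apply: (@continuous_row_mx _ _ _ _ (cst 0) id);
    [exact: cst_continuous|exact: cvg_id].
Qed.

End Ck_theory.

Section product_manifold.
Context {R : realType} (M N : manifold R).

Let Idx := (chart_index M * chart_index N)%type.
Let dom (i : Idx) : set (M * N) := chart_dom i.1 `*` chart_dom i.2.
Let phi (i : Idx) (p : M * N) : 'rV[R]_(dim M + dim N) :=
  row_mx (chart i.1 p.1) (chart i.2 p.2).
Let psi (i : Idx) (x : 'rV[R]_(dim M + dim N)) : M * N :=
  (param i.1 (lsubmx x), param i.2 (rsubmx x)).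

Let phi_img (i : Idx) (A : set M) (B : set N) :
  phi i @` (A `*` B) =
  lsubmx @^-1` (chart i.1 @` A) `&` rsubmx @^-1` (chart i.2 @` B).
Proof.
apply/seteqP; split=> [_ [p [Ap Bp] <-]|x [[p Ap px] [q Bq qx]]].
  by split=> /=; rewrite /phi ?row_mxKl ?row_mxKr; [exists p.1|exists p.2].
by exists (p, q) => //; rewrite /phi /= px qx hsubmxK.
Qed.

Let open_img (i : Idx) (A : set M) (B : set N) :
  open (chart i.1 @` A) -> open (chart i.2 @` B) -> open (phi i @` (A `*` B)).
Proof.
move=> oA oB; rewrite phi_img; apply: openI; apply: open_comp => // x _.
- exact: continuous_lsubmx.
- exact: continuous_rsubmx.
Qed.

Lemma product_nonempty : [set: M * N] !=set0.
Proof.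
have [p _] := manifold_nonempty M; have [q _] := manifold_nonempty N.
by exists (p, q).
Qed.

Lemma product_hausdorff : hausdorff_space (M * N)%type.
Proof.
move=> [p1 q1] [p2 q2] pq; congr (_, _).
- apply: manifold_hausdorff => A B pA pB.
  have [||[x y] [/= [Ax _] [Bx _]]] := pq (A `*` setT) (B `*` setT).
  + by exists (A, setT) => //=; split=> //; exact: filterT.
  + by exists (B, setT) => //=; split=> //; exact: filterT.
  by exists x.
- apply: manifold_hausdorff => A B pA pB.
  have [||[x y] [/= [_ Ay] [_ By]]] := pq (setT `*` A) (setT `*` B).
  + by exists (setT, A) => //=; split=> //; exact: filterT.
  + by exists (setT, B) => //=; split=> //; exact: filterT.
  by exists y.
Qed.

Lemma product_second_countable : @second_countable (M * N)%type.
Proof.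
have [B cB [oB bB]] := manifold_second_countable M.
have [C cC [oC bC]] := manifold_second_countable N.
exists ((fun UV => UV.1 `*` UV.2) @` (B `*` C)).
  by apply: sub_countable (countableX cB cC); exact: card_image_le.
split=> [_ [[U V] /= [BU CV] <-]|].
  rewrite openE => -[x y] /= [Ux Vy].
  by exists (U, V) => //=; split; apply: open_nbhs_nbhs; split=> //;
    [exact: oB|exact: oC].
move=> [x y] A [[P Q] /= [xP yQ] PQA].
have [U [BU Ux] UP] := bB _ _ xP; have [V [CV Vy] VQ] := bC _ _ yQ.
exists (U `*` V) => /=.
  by split=> //; exists (U, V).
by move=> z [Uz Vz]; apply: PQA; split; [exact: UP|exact: VQ].
Qed.

Let chart_image_open (P : manifold R) i (A : set P) :
  open A -> A `<=` chart_dom i -> open (chart i @` A).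
Proof.
move=> oA Ai.
have -> : chart i @` A = (chart i @` chart_dom i) `&` param i @^-1` A.
  apply/seteqP; split=> [_ [p Ap <-]|_ [[p ip <-]] /= Ap].
    by split=> /=; [exists p => //; exact: Ai|rewrite chartK//; exact: Ai].
  by exists p => //; rewrite chartK in Ap.
rewrite openE => x [ix Ax]; apply: filterI.
  by apply: open_nbhs_nbhs; split=> //; exact: chart_img_open.
by apply: (param_continuous ix); exact: open_nbhs_nbhs.
Qed.

Let phi_continuous (i : Idx) p : dom i p -> {for p, continuous (phi i)}.
Proof.
case: p => p q [/= ip iq]; apply: continuous_row_mx.
- by apply: (@continuous_comp _ _ _ fst); [exact: cvg_fst|exact: chart_continuous].
- by apply: (@continuous_comp _ _ _ snd); [exact: cvg_snd|exact: chart_continuous].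
Qed.

Let psi_continuous (i : Idx) x :
  (phi i @` dom i) x -> {for x, continuous (psi i)}.
Proof.
rewrite phi_img => -[/= ix jx]; apply: cvg_pair => /=.
- exact: nbhs_filter.
- exact: (continuous_comp (@continuous_lsubmx _ _ _ _ x) (param_continuous ix)).
- exact: (continuous_comp (@continuous_rsubmx _ _ _ _ x) (param_continuous jx)).
Qed.

Let phi_smooth (i j : Idx) :
  smooth_on (phi i @` (dom i `&` dom j)) (phi j \o psi i).
Proof.
pose A := chart_dom i.1 `&` chart_dom j.1.
pose B := chart_dom i.2 `&` chart_dom j.2.
have oA : open A by apply: openI; exact: chart_dom_open.
have oB : open B by apply: openI; exact: chart_dom_open.
have oiA : open (chart i.1 @` A) by apply: chart_image_open => // p [].
have oiB : open (chart i.2 @` B) by apply: chart_image_open => // p [].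
have -> : dom i `&` dom j = A `*` B.
  by apply/seteqP; split=> p [[? ?] [? ?]].
move=> k; apply: Ck_on_row_mx; first exact: open_img.
- apply: (Ck_on_sub _ (Ck_on_compr oiA (@continuous_lsubmx _ _ _ _)
    (chart_smooth i.1 j.1 k))).
  by rewrite phi_img => x [].
- apply: (Ck_on_sub _ (Ck_on_compr oiB (@continuous_rsubmx _ _ _ _)
    (chart_smooth i.2 j.2 k))).
  by rewrite phi_img => x [].
Qed.

Let dom_open i : open (dom i).
Proof.
rewrite openE => -[x y] /= [ix iy].
by exists (chart_dom i.1, chart_dom i.2) => //=; split;
  apply: open_nbhs_nbhs; split=> //; exact: chart_dom_open.
Qed.

Let phiK i p : dom i p -> psi i (phi i p) = p.
Proof.
by case: p => p q [/= ip iq]; rewrite /psi /phi row_mxKl row_mxKr /= !chartK.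
Qed.

Definition product_manifold : manifold R := {|
  point := (M * N)%type;
  dim := dim M + dim N;
  chart_index := Idx;
  chart_dom := dom;
  chart := phi;
  param := psi;
  chart_at := fun p => (chart_at p.1, chart_at p.2);
  manifold_nonempty := product_nonempty;
  manifold_hausdorff := product_hausdorff;
  manifold_second_countable := product_second_countable;
  chart_atP := fun p => conj (chart_atP p.1) (chart_atP p.2);
  chart_dom_open := dom_open;
  chart_img_open := fun i => open_img (chart_img_open i.1) (chart_img_open i.2);
  chartK := phiK;
  chart_continuous := phi_continuous;
  param_continuous := psi_continuous;
  chart_smooth := phi_smooth
|}.

End product_manifold.

Section calculus.
Context {R : realType}.

(* The tangent space at p is R^dim: a tangent vector at p is represented by its
   components in the chart [chart_at p], its components in another chart being
   obtained through the differential of the transition map ([components]). *)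
Local Notation tangent M := 'rV[R]_(dim M).

Definition vfield (M : manifold R) : Type := M -> tangent M.

Definition form2 (M : manifold R) : Type := M -> tangent M -> tangent M -> R.

Definition smooth_fun (M : manifold R) (f : M -> R) : Prop :=
  forall i, smooth_on (chart i @` chart_dom i) (f \o param i).

Definition dfun (M : manifold R) (f : M -> R) (p : M) (v : tangent M) : R :=
  'd (f \o param (chart_at p)) (chart (chart_at p) p) v.

Definition dmap (M N : manifold R) (F : M -> N) (p : M) (v : tangent M) :
    tangent N :=
  'd (chart (chart_at (F p)) \o F \o param (chart_at p)) (chart (chart_at p) p) v.

Definition components (M : manifold R) (i : chart_index M) (p : M)
    (v : tangent M) : 'rV[R]_(dim M) :=
  'd (chart i \o param (chart_at p)) (chart (chart_at p) p) v.

(* The tangent vector at p whose components in the chart i are u. *)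
Definition of_components (M : manifold R) (i : chart_index M) (p : M)
    (u : 'rV[R]_(dim M)) : tangent M :=
  'd (chart (chart_at p) \o param i) (chart i p) u.

Definition smooth_vfield (M : manifold R) (X : vfield M) : Prop :=
  forall i, smooth_on (chart i @` chart_dom i)
    (fun x => components i (param i x) (X (param i x))).

Record riemannian_metric (M : manifold R) (g : form2 M) : Prop := {
  metric_linear : forall p a u v w, g p (a *: u + v) w = a * g p u w + g p v w;
  metric_sym : forall p v w, g p v w = g p w v;
  metric_pos : forall p v, v != 0 -> 0 < g p v v;
  metric_smooth : forall i u v, smooth_on (chart i @` chart_dom i)
    (fun x => g (param i x) (of_components i (param i x) u)
                            (of_components i (param i x) v))
}.

(* The set below is a singleton, by the nondegeneracy of a Riemannian metric. *)
Definition grad (M : manifold R) (g : form2 M) (f : M -> R) : vfield M :=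
  fun p => xget 0 [set v | forall w, g p v w = dfun f p w].

(* A connection is only constrained on smooth vector fields. *)
Record affine_connection (M : manifold R)
    (nabla : vfield M -> vfield M -> vfield M) : Prop := {
  connection_smooth : forall X Y, smooth_vfield X -> smooth_vfield Y ->
    smooth_vfield (nabla X Y);
  connection_addl : forall X X' Y,
    smooth_vfield X -> smooth_vfield X' -> smooth_vfield Y ->
    forall p, nabla (fun q => X q + X' q) Y p = nabla X Y p + nabla X' Y p;
  connection_scalel : forall f X Y,
    smooth_fun f -> smooth_vfield X -> smooth_vfield Y ->
    forall p, nabla (fun q => f q *: X q) Y p = f p *: nabla X Y p;
  connection_addr : forall X Y Y',
    smooth_vfield X -> smooth_vfield Y -> smooth_vfield Y' ->
    forall p, nabla X (fun q => Y q + Y' q) p = nabla X Y p + nabla X Y' p;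
  connection_leibniz : forall f X Y,
    smooth_fun f -> smooth_vfield X -> smooth_vfield Y ->
    forall p, nabla X (fun q => f q *: Y q) p =
              dfun f p (X p) *: Y p + f p *: nabla X Y p
}.

Definition conjugate (M : manifold R) (g : form2 M)
    (nabla nablas : vfield M -> vfield M -> vfield M) : Prop :=
  forall X Y Z, smooth_vfield X -> smooth_vfield Y -> smooth_vfield Z ->
  forall p, dfun (fun q => g q (Y q) (Z q)) p (X p) =
            g p (nabla X Y p) (Z p) + g p (Y p) (nablas X Z p).

Definition dualistic_structure (M : manifold R) (g : form2 M)
    (nabla nablas : vfield M -> vfield M -> vfield M) : Prop :=
  [/\ affine_connection nabla, affine_connection nablas &
      conjugate g nabla nablas].

Definition pullback (M N : manifold R) (F : M -> N) (g : form2 N) : form2 M :=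
  fun p v w => g (F p) (dmap F p v) (dmap F p w).

Definition hlift (M1 M2 : manifold R) (f : M1 -> R) :
  product_manifold M1 M2 -> R := fun p => f p.1.

Definition vlift (M1 M2 : manifold R) (f : M2 -> R) :
  product_manifold M1 M2 -> R := fun p => f p.2.

Definition warped_metric (M1 M2 : manifold R) (g1 : form2 M1) (g2 : form2 M2)
    (f1 : M1 -> R) (f2 : M2 -> R) (c : R) : form2 (product_manifold M1 M2) :=
  let f1h := hlift (M2 := M2) f1 in let f2v := vlift (M1 := M1) f2 in
  fun p v w =>
    f2v p ^+ 2 * pullback (M := product_manifold M1 M2) fst g1 p v w
    + f1h p ^+ 2 * pullback (M := product_manifold M1 M2) snd g2 p v w
    + c * f1h p * f2v p *
      (dfun f1h p v * dfun f2v p w + dfun f2v p v * dfun f1h p w).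

End calculus.

(* Main.v *)
Require Import Defs.
From HB Require Import structures.
From mathcomp Require Import all_boot all_order all_algebra.
From mathcomp Require Import all_classical all_reals all_analysis.
From mathcomp Require Import ring.
Import Order.TTheory GRing.Theory Num.Theory numFieldNormedType.Exports.

Set Implicit Arguments.
Unset Strict Implicit.
Unset Printing Implicit Defensive.

Local Open Scope classical_set_scope.
Local Open Scope ring_scope.

(* Fix q in M2. For horizontal lifts X, Y of vector fields on M1, project
   nabla_X Y at the points of the slice M1 x {q} onto the tangent space of M1,
   orthogonally with respect to G. Since G (w, X) = f2(q)^2 g1 (w', X) with
   w' = w1 + c (f1 / f2(q)) df2(w2) grad f1 for w = (w1, w2), the projection is
   w |-> w', and it depends smoothly on the base point; restricting the
   conjugacy of nabla and nabla* to the slice and dividing by the constant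
   f2(q)^2 gives the conjugacy of the projected connections with respect to g1. *)

Local Notation dim := Defs.dim.

(** * Closure properties of maps of class C^k *)

Section smooth_calculus.
Context {R : realType}.
Implicit Types V W : normedModType R.

Lemma continuous_sum V W (I : Type) (r : seq I) (F : I -> V -> W) :
  (forall i, continuous (F i)) -> continuous (fun x => \sum_(i <- r) F i x).
Proof.
move=> cF; elim: r => [|i r IH] x.
  have -> : (fun x => \sum_(i <- [::]) F i x) = fun=> 0.
    by apply/funext => y; rewrite big_nil.
  exact: cst_continuous.
have -> : (fun x => \sum_(j <- i :: r) F j x) = F i + (fun x => \sum_(j <- r) F j x).
  by apply/funext => y; rewrite big_cons.
by apply: continuousD; [exact: cF|exact: IH].
Qed.

(** On a row space a linear map is a finite sum of coordinates times fixed vectors, and coordinates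
    are continuous. *)
Lemma linear_rV_continuous n W (L : {linear 'rV[R]_n -> W}) : continuous L.
Proof.
have -> : L = (fun u => \sum_j u 0 j *: L (delta_mx 0 j)) :> (_ -> _).
  by apply/funext => u; rewrite {1}(row_sum_delta u) linear_sum;
    apply: eq_bigr => j _; rewrite linearZ.
apply: continuous_sum => j u.
exact: (@cvgZr_tmp R W _ (nbhs u) _ _ _ _ (@coord_continuous R 1 n 0 j u)).
Qed.

(** Needed in the inductions for products and inverses, where the derivative of order [k.+1] data
    involves the functions themselves at order [k]. *)
Lemma Ck_onS V W k (U : set V) (f : V -> W) : Ck_on k.+1 U f -> Ck_on k U f.
Proof.
elim: k f => [|k IH] f [df Df].
  by move=> x /df /differentiable_continuous.
by split=> // v; exact: IH (Df v).
Qed.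

Lemma Ck_on_cst V W k (U : set V) (w : W) : Ck_on k U (fun=> w).
Proof.
elim: k w => [|k IH] w /=; first by move=> x _; exact: cst_continuous.
split=> // v.
have -> : 'D_v (fun _ : V => w) = fun=> 0 by apply/funext => x; exact: derive_cst.
exact: IH.
Qed.

Lemma Ck_on_sum V W k (U : set V) (I : Type) (r : seq I) (F : I -> V -> W) :
  open U -> (forall i, Ck_on k U (F i)) ->
  Ck_on k U (fun x => \sum_(i <- r) F i x).
Proof.
move=> oU CF; elim: r => [|i r IH].
  by apply: eq_Ck_on (Ck_on_cst k U (0 : W)) => // x _; rewrite big_nil.
by apply: eq_Ck_on (Ck_onD oU (CF i) IH) => // x _; rewrite big_cons.
Qed.

Lemma Ck_onM V k (U : set V) (f g : V -> R) :
  open U -> Ck_on k U f -> Ck_on k U g -> Ck_on k U (fun x => f x * g x).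
Proof.
move=> oU; elim: k f g => [|k IH] f g.
  by move=> cf cg x Ux; apply: continuousM; [exact: cf|exact: cg].
move=> Cf Cg; have [[df Df] [dg Dg]] := (Cf, Cg).
split=> [x Ux|v]; first by apply: differentiableM; [exact: df|exact: dg].
apply: (eq_Ck_on oU _ (Ck_onD oU (IH _ _ (Ck_onS Cf) (Dg v))
  (IH _ _ (Ck_onS Cg) (Df v)))) => x Ux.
rewrite -[LHS]/(f x *: 'D_v g x + g x *: 'D_v f x) -deriveM //.
- exact/diff_derivable/df.
- exact/diff_derivable/dg.
Qed.

Lemma Ck_onN V W k (U : set V) (f : V -> W) :
  open U -> Ck_on k U f -> Ck_on k U (fun x => - f x).
Proof.
move=> oU; apply: (@Ck_on_compl _ _ _ _ _ _ _ (-%R : {linear W -> W})) => //.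
exact: opp_continuous.
Qed.

(** The derivative of the inverse is [- f^-1 * f^-1 * 'D_v f]: it involves the inverse of the same
    [f], already of class C^k by induction. *)
Lemma Ck_on_inv V k (U : set V) (f : V -> R) :
  open U -> (forall x, U x -> f x != 0) -> Ck_on k U f ->
  Ck_on k U (fun x => (f x)^-1).
Proof.
move=> oU f0; elim: k => [|k IH].
  by move=> cf x Ux; apply: cvgV; [exact: f0|exact: cf].
move=> Cf; have [df Df] := Cf; have Cfi := IH (Ck_onS Cf).
split=> [x Ux|v]; first by apply: differentiableV; [exact: df|exact: f0].
apply: (eq_Ck_on oU _ (Ck_onM oU (Ck_onN oU (Ck_onM oU Cfi Cfi)) (Df v))) => x Ux.
by rewrite deriveV ?f0//; [rewrite -exprVn expr2|exact/diff_derivable/df].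
Qed.

Lemma Ck_on_prod V k (U : set V) (I : Type) (r : seq I) (F : I -> V -> R) :
  open U -> (forall i, Ck_on k U (F i)) ->
  Ck_on k U (fun x => \prod_(i <- r) F i x).
Proof.
move=> oU CF; elim: r => [|i r IH].
  by apply: eq_Ck_on (Ck_on_cst k U (1 : R)) => // x _; rewrite big_nil.
by apply: eq_Ck_on (Ck_onM oU (CF i) IH) => // x _; rewrite big_cons.
Qed.

(** By the Leibniz expansion, a determinant is a sum over permutations of signed products of
    entries. *)
Lemma Ck_on_det V k (U : set V) n (A : V -> 'M[R]_n) :
  open U -> (forall i j, Ck_on k U (fun x => A x i j)) ->
  Ck_on k U (fun x => \det (A x)).
Proof.
move=> oU CA; apply: Ck_on_sum => // s; apply: Ck_onM => //.
  exact: Ck_on_cst.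
exact: Ck_on_prod.
Qed.

(** The codomain is [R^o], the field as a module over itself, so that the coordinate is a linear map
    to which [Ck_on_compl] applies. *)
Definition rV_coord n (j : 'I_n) (u : 'rV[R]_n) : R^o := u 0 j.

Fact rV_coord_linear n (j : 'I_n) : linear (rV_coord j).
Proof. by move=> a u v; rewrite /rV_coord !mxE. Qed.

HB.instance Definition _ n (j : 'I_n) :=
  GRing.isLinear.Build R 'rV[R]_n R^o *:%R (rV_coord j) (rV_coord_linear j).

Definition scale_at V (v : V) (a : R^o) : V := (a : R) *: v.

Fact scale_at_linear V (v : V) : linear (scale_at v).
Proof. by move=> a b c; rewrite /scale_at scalerDl scalerA. Qed.

HB.instance Definition _ V (v : V) :=
  GRing.isLinear.Build R R^o V *:%R (scale_at v) (scale_at_linear v).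

Lemma Ck_on_coord V k (U : set V) n (f : V -> 'rV[R]_n) j :
  open U -> Ck_on k U f -> Ck_on k U (fun x => f x 0 j).
Proof.
move=> oU Cf.
apply: (@Ck_on_compl R V _ _ k U f (rV_coord j)) => //.
exact: linear_rV_continuous.
Qed.

Lemma Ck_on_rV V k (U : set V) n (f : V -> 'rV[R]_n) :
  open U -> (forall j, Ck_on k U (fun x => f x 0 j)) -> Ck_on k U f.
Proof.
move=> oU Cf.
have CF j : Ck_on k U (fun x => f x 0 j *: (delta_mx 0 j : 'rV[R]_n)).
  apply: (@Ck_on_compl R V R^o _ k U (fun x => f x 0 j) (scale_at _)) => // a.
  by apply: cvgZr_tmp; exact: cvg_id.
by apply: eq_Ck_on (Ck_on_sum (index_enum _) oU CF) => // x _; rewrite [RHS]row_sum_delta.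
Qed.

Lemma Ck_onZ V k (U : set V) n (a : V -> R) (f : V -> 'rV[R]_n) :
  open U -> Ck_on k U a -> Ck_on k U f -> Ck_on k U (fun x => a x *: f x).
Proof.
move=> oU Ca Cf; apply: Ck_on_rV => // j.
apply: (@eq_Ck_on R _ _ _ _ (fun x => a x * f x 0 j)) => // [x _|].
  by rewrite mxE.
by apply: Ck_onM => //; exact: Ck_on_coord.
Qed.

(** The difference quotient of the composite at [y] in direction [v] is that of [f] at [L y + a] in
    direction [L v], so derivatives stay of the same form. This is applied to the embedding of a
    slice, which is affine in charts. *)
Lemma Ck_on_affine V V' W k (U : set V) (f : V -> W) (L : {linear V' -> V})
    (a : V) : open U -> continuous L -> Ck_on k U f ->
  Ck_on k ((fun y => L y + a) @^-1` U) (fun y => f (L y + a)).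
Proof.
move=> oU cL.
have dA y : differentiable (fun y => L y + a) y.
  exact: (differentiableD (linear_differentiable y cL) (differentiable_cst a y)).
elim: k f => [|k IH] f.
  move=> cf x Ux; apply: (@continuous_comp _ _ _ (fun y => L y + a) f).
    exact/differentiable_continuous/dA.
  exact: cf.
move=> [df Df]; split=> [x Ux|v].
  by apply: (@differentiable_comp _ _ _ _ (fun y => L y + a) f) => //; exact: df.
have -> : 'D_v (fun y => f (L y + a)) = (fun y => 'D_(L v) f (L y + a)).
  apply/funext => y; rewrite /derive.
  suff -> : (fun h : R => h^-1 *: (((fun y => f (L y + a)) \o shift y) (h *: v)
        - f (L y + a))) =
      (fun h => h^-1 *: ((f \o shift (L y + a)) (h *: L v) - f (L y + a))) by [].
  by apply/funext => h /=; rewrite (linearP L h v y) addrA.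
exact: IH (Df _).
Qed.

End smooth_calculus.

Lemma near_eq_diff (R : realType) (V W : normedModType R) (f g : V -> W) x v :
  (\forall y \near x, f y = g y) -> differentiable f x -> 'd g x v = 'd f x v.
Proof.
move=> fg df; rewrite -!deriveE//; last exact: near_eq_differentiable df.
by apply/esym/near_eq_derive.
Qed.

(** * Changes of charts, components of tangent vectors, smooth fields *)

Section charts.
Context {R : realType} {M : manifold R}.
Implicit Types (i j : chart_index M) (p : M) (f : M -> R) (X Y : vfield M).

Lemma param_chart_dom i x : (chart i @` chart_dom i) x -> chart_dom i (param i x).
Proof. by move=> [p ip <-]; rewrite chartK. Qed.

Lemma paramK i x : (chart i @` chart_dom i) x -> chart i (param i x) = x.
Proof. by move=> [p ip <-]; rewrite chartK. Qed.

Lemma chart_img i p : chart_dom i p -> (chart i @` chart_dom i) (chart i p).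
Proof. by move=> ip; exists p. Qed.

Lemma near_param_dom i j p : chart_dom i p -> chart_dom j p ->
  \forall x \near chart i p, chart_dom j (param i x).
Proof.
move=> ip jp; apply: (param_continuous (chart_img ip)).
by rewrite chartK//; apply: open_nbhs_nbhs; split=> //; exact: chart_dom_open.
Qed.

Lemma transition_differentiable i j p : chart_dom i p -> chart_dom j p ->
  differentiable (chart j \o param i) (chart i p).
Proof. by move=> ip jp; apply: (chart_smooth i j 1).1; exists p. Qed.

Lemma near_chart_change W (F : M -> W) i j p : chart_dom i p -> chart_dom j p ->
  \forall x \near chart i p,
    ((F \o param j) \o (chart j \o param i)) x = (F \o param i) x.
Proof.
move=> ip jp; apply: filterS (near_param_dom ip jp) => x jx /=.
by rewrite chartK.
Qed.

(** The chain rule through the transition map. The factorization through chart [j] holds only near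
    [chart i p], since [param j] inverts [chart j] only on its domain; hence the detour through
    [near_eq_diff]. *)
Lemma diff_chart_change (W : normedModType R) (F : M -> W) i j p u :
  chart_dom i p -> chart_dom j p ->
  differentiable (F \o param j) (chart j p) ->
  'd (F \o param i) (chart i p) u =
  'd (F \o param j) (chart j p) ('d (chart j \o param i) (chart i p) u).
Proof.
move=> ip jp dF; have dt := transition_differentiable ip jp.
have jE : (chart j \o param i) (chart i p) = chart j p by rewrite /= chartK.
have dF' : differentiable (F \o param j) ((chart j \o param i) (chart i p)).
  by rewrite jE.
apply: etrans (near_eq_diff u (near_chart_change F ip jp)
  (differentiable_comp dt dF')) _.
apply: etrans (congr1 (@^~ u) (diff_comp dt dF')) _.
exact: (congr1 (fun y => 'd (F \o param j) y
  ('d (chart j \o param i) (chart i p) u)) jE).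
Qed.

Lemma diff_chart_param i p u : chart_dom i p ->
  'd (chart i \o param i) (chart i p) u = u.
Proof.
move=> ip; apply: (etrans (@near_eq_diff _ _ _ id _ _ _ _ _)).
- have := open_nbhs_nbhs (conj (chart_img_open i) (chart_img ip)).
  by apply: filterS => x ix; rewrite /= paramK.
- exact: ex_diff.
- exact: (congr1 (@^~ u) (@diff_lin _ _ _ idfun _ (fun=> cvg_id))).
Qed.

Lemma components_chart_at p (v : 'rV[R]_(dim M)) :
  components (chart_at p) p v = v.
Proof. exact/diff_chart_param/chart_atP. Qed.

Lemma componentsD i p u v :
  components i p (u + v) = components i p u + components i p v.
Proof. exact: linearD. Qed.

Lemma componentsZ i p a u : components i p (a *: u) = a *: components i p u.
Proof. exact: linearZ. Qed.

Lemma components0 i p : components i p 0 = 0.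
Proof. exact: linear0. Qed.

Lemma of_components_sum i p (I : Type) (r : seq I) (F : I -> 'rV[R]_(dim M)) :
  of_components i p (\sum_(a <- r) F a) = \sum_(a <- r) of_components i p (F a).
Proof. exact: linear_sum. Qed.

Lemma of_componentsZ i p a u :
  of_components i p (a *: u) = a *: of_components i p u.
Proof. exact: linearZ. Qed.

Lemma dfunD f p u v : dfun f p (u + v) = dfun f p u + dfun f p v.
Proof. exact: linearD. Qed.

Lemma dfunZ f p a u : dfun f p (a *: u) = a * dfun f p u.
Proof. exact: linearZ. Qed.

Lemma dfun0 f p : dfun f p 0 = 0.
Proof. exact: linear0. Qed.

Lemma dfun_sum f p (I : Type) (r : seq I) (F : I -> 'rV[R]_(dim M)) :
  dfun f p (\sum_(a <- r) F a) = \sum_(a <- r) dfun f p (F a).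
Proof. exact: linear_sum. Qed.

(** By the chain rule the composite is the differential of [chart] after [param] for a single chart,
    which is the identity near the point. *)
Lemma componentsK i p : chart_dom i p ->
  cancel (components i p) (@of_components R M i p).
Proof.
move=> ip v; have cp := chart_atP p.
apply: etrans (esym (diff_chart_change v cp ip _)) _.
  exact: transition_differentiable.
exact: diff_chart_param.
Qed.

Lemma of_componentsK i p : chart_dom i p ->
  cancel (@of_components R M i p) (components i p).
Proof.
move=> ip v; have cp := chart_atP p.
apply: etrans (esym (diff_chart_change v ip cp _)) _.
  exact: transition_differentiable.
exact: diff_chart_param.
Qed.

Lemma smooth_fun_differentiable f i p : smooth_fun f -> chart_dom i p ->
  differentiable (f \o param i) (chart i p).
Proof. by move=> sf ip; apply: (sf i 1).1; exact: chart_img. Qed.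

Lemma dfun_of_components f i p u : smooth_fun f -> chart_dom i p ->
  dfun f p (of_components i p u) = 'd (f \o param i) (chart i p) u.
Proof.
move=> sf ip; have cp := chart_atP p.
by apply/esym/diff_chart_change => //; exact: smooth_fun_differentiable.
Qed.

Lemma smooth_funM f g : smooth_fun f -> smooth_fun g ->
  smooth_fun (fun p => f p * g p).
Proof. by move=> sf sg i k; exact: Ck_onM (chart_img_open i) (sf i k) (sg i k). Qed.

Lemma dfunM f g p v : smooth_fun f -> smooth_fun g ->
  dfun (fun q => f q * g q) p v = f p * dfun g p v + g p * dfun f p v.
Proof.
move=> sf sg; have ip := chart_atP p.
have df := smooth_fun_differentiable sf ip.
have dg := smooth_fun_differentiable sg ip.
rewrite /dfun -deriveE//; last first.
  exact: (@differentiableM _ _ (f \o param (chart_at p)) (g \o param (chart_at p))).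
rewrite (@deriveM _ _ (f \o param (chart_at p)) (g \o param (chart_at p)));
  [|exact: diff_derivable|exact: diff_derivable].
by rewrite !deriveE//= chartK.
Qed.

Lemma smooth_vfieldD X Y : smooth_vfield X -> smooth_vfield Y ->
  smooth_vfield (fun p => X p + Y p).
Proof.
move=> sX sY i k; apply: eq_Ck_on (Ck_onD (chart_img_open i) (sX i k) (sY i k)).
  exact: chart_img_open.
by move=> x _; rewrite componentsD.
Qed.

Lemma smooth_vfieldZ f X : smooth_fun f -> smooth_vfield X ->
  smooth_vfield (fun p => f p *: X p).
Proof.
move=> sf sX i k; apply: eq_Ck_on (Ck_onZ (chart_img_open i) (sf i k) (sX i k)).
  exact: chart_img_open.
by move=> x _; rewrite componentsZ.
Qed.

End charts.

(** * Gram matrices of a Riemannian metric and smoothness of gradients *)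

Section metric.
Context {R : realType} {M : manifold R} {g : form2 M}.
Hypothesis gP : riemannian_metric g.
Implicit Types (i : chart_index M) (p : M) (u v w : 'rV[R]_(dim M)).

Lemma metricDl p u v w : g p (u + v) w = g p u w + g p v w.
Proof. by have := metric_linear gP p 1 u v w; rewrite scale1r mul1r. Qed.

Lemma metric0l p w : g p 0 w = 0.
Proof. by apply: (@addrI _ (g p 0 w)); rewrite -metricDl !addr0. Qed.

Lemma metricZl p a u w : g p (a *: u) w = a * g p u w.
Proof. by have := metric_linear gP p a u 0 w; rewrite metric0l !addr0. Qed.

Lemma metric_suml p (I : Type) (r : seq I) (F : I -> 'rV[R]_(dim M)) w :
  g p (\sum_(a <- r) F a) w = \sum_(a <- r) g p (F a) w.
Proof.
elim: r => [|a r IH]; first by rewrite !big_nil metric0l.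
by rewrite !big_cons metricDl IH.
Qed.

(** The coordinate vectors of chart [i] at [p], in the sense of partial derivatives. *)
Definition frame i p (a : 'I_(dim M)) : 'rV[R]_(dim M) :=
  of_components i p (delta_mx 0 a).

Lemma frame_expansion i p v : chart_dom i p ->
  v = \sum_a components i p v 0 a *: frame i p a.
Proof.
move=> ip; rewrite -{1}[v](componentsK ip) {1}[components i p v]row_sum_delta.
by rewrite of_components_sum; apply: eq_bigr => a _; rewrite of_componentsZ.
Qed.

Definition gram i p : 'M[R]_(dim M) :=
  \matrix_(a, b) g p (frame i p a) (frame i p b).

Lemma metric_frame i p v b : chart_dom i p ->
  g p v (frame i p b) = (components i p v *m gram i p) 0 b.
Proof.
move=> ip; rewrite {1}(frame_expansion v ip) metric_suml mxE.
by apply: eq_bigr => a _; rewrite metricZl mxE.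
Qed.

Lemma metric_gram i p v w : chart_dom i p ->
  g p v w = \sum_b (components i p v *m gram i p) 0 b * components i p w 0 b.
Proof.
move=> ip; rewrite (Defs.metric_sym gP) {1}(frame_expansion w ip) metric_suml.
apply: eq_bigr => b _.
by rewrite metricZl (Defs.metric_sym gP) metric_frame// mulrC.
Qed.

(** A nonzero row in the kernel would be the components of a nonzero vector [v] with [g p v v = 0],
    against positivity. *)
Lemma gram_unit i p : chart_dom i p -> gram i p \in unitmx.
Proof.
move=> ip; rewrite -row_free_unit; apply/inj_row_free => u u0.
apply/eqP; apply: contraT => un0.
have v0 : of_components i p u != 0.
  apply: contra_neq un0 => v0; rewrite -[u](of_componentsK ip) v0.
  exact: components0.
have := metric_pos gP p v0.
rewrite (metric_gram _ _ ip) of_componentsK// u0 big1 ?ltxx// => b _.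
by rewrite mxE mul0r.
Qed.

Lemma gram_smooth i a b k :
  Ck_on k (chart i @` chart_dom i) (fun x => gram i (param i x) a b).
Proof.
apply: eq_Ck_on (metric_smooth gP i (delta_mx 0 a) (delta_mx 0 b) k).
  exact: chart_img_open.
by move=> x _; rewrite mxE.
Qed.

Lemma metric_smooth_fun Y Z : smooth_vfield Y -> smooth_vfield Z ->
  smooth_fun (fun p => g p (Y p) (Z p)).
Proof.
move=> sY sZ i k; have oU := chart_img_open i.
pose y x := components i (param i x) (Y (param i x)).
pose z x := components i (param i x) (Z (param i x)).
apply: (@eq_Ck_on R _ _ k _ (fun x =>
    \sum_b (\sum_a y x 0 a * gram i (param i x) a b) * z x 0 b)) => //.
  move=> x ix; rewrite /= (metric_gram _ _ (param_chart_dom ix)).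
  by apply: eq_bigr => b _; rewrite mxE.
apply: Ck_on_sum => // b; apply: Ck_onM => //; last exact: Ck_on_coord (sZ i k).
apply: Ck_on_sum => // a; apply: Ck_onM => //; first exact: Ck_on_coord (sY i k).
exact: gram_smooth.
Qed.

Context {f : M -> R}.
Hypothesis sf : smooth_fun f.

Definition dfun_components i p : 'rV[R]_(dim M) := \row_b dfun f p (frame i p b).

Lemma dfun_expansion i p w : chart_dom i p ->
  dfun f p w = \sum_b dfun_components i p 0 b * components i p w 0 b.
Proof.
move=> ip; rewrite {1}(frame_expansion w ip) dfun_sum.
by apply: eq_bigr => b _; rewrite dfunZ mxE mulrC.
Qed.

Lemma grad_spec p w : g p (grad g f p) w = dfun f p w.
Proof.
have ip := chart_atP p.
suff : [set v | forall w, g p v w = dfun f p w] (grad g f p) by apply.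
apply: xgetPex.
(* [xget] returns its default [0] unless the set is inhabited, so a witness is exhibited: in
   coordinates the gradient is the row of partial derivatives times the inverse Gram matrix. *)
exists (of_components (chart_at p) p
  (dfun_components (chart_at p) p *m invmx (gram (chart_at p) p))) => z.
rewrite (metric_gram _ _ ip) (dfun_expansion z ip) of_componentsK//.
by rewrite mulmxKV// gram_unit.
Qed.

Lemma components_grad i p : chart_dom i p ->
  components i p (grad g f p) = dfun_components i p *m invmx (gram i p).
Proof.
move=> ip; apply: (canRL (mulmxK (gram_unit ip))); apply/rowP => b.
by rewrite -metric_frame// grad_spec mxE.
Qed.

Lemma dfun_components_smooth i b k :
  Ck_on k (chart i @` chart_dom i) (fun x => dfun_components i (param i x) 0 b).
Proof.
(* The partial derivatives are of class C^k because [f] is of class C^(k+1). *)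
apply: eq_Ck_on ((sf i k.+1).2 (delta_mx 0 b)); first exact: chart_img_open.
move=> x ix; have ip := param_chart_dom ix.
rewrite mxE dfun_of_components// paramK// deriveE//.
exact: (sf i 1).1.
Qed.

(** Cramer's rule writes the inverse Gram matrix as its adjugate over its determinant; the entries
    of the adjugate are signed minors of smooth entries. *)
Lemma grad_smooth : smooth_vfield (grad g f).
Proof.
move=> i k; have oU := chart_img_open i.
apply: (@eq_Ck_on R _ _ k _ (fun x => (\det (gram i (param i x)))^-1 *:
    (dfun_components i (param i x) *m \adj (gram i (param i x))))) => //.
  move=> x /param_chart_dom ip.
  by rewrite components_grad// /invmx gram_unit// scalemxAr.
apply: Ck_onZ => //.
  apply: Ck_on_inv => // [x /param_chart_dom /gram_unit|].
    by rewrite unitmxE unitfE.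
  by apply: Ck_on_det => // a b; exact: gram_smooth.
apply: Ck_on_rV => // b.
apply: (@eq_Ck_on R _ _ k _ (fun x => \sum_a dfun_components i (param i x) 0 a *
    ((-1) ^+ (b + a) * \det (row' b (col' a (gram i (param i x))))))) => //.
  by move=> x _; rewrite mxE; apply: eq_bigr => a _; rewrite [X in _ = _ * X]mxE.
apply: Ck_on_sum => // a; apply: Ck_onM => //; first exact: dfun_components_smooth.
apply: Ck_onM => //; first exact: Ck_on_cst.
apply: Ck_on_det => // c d.
apply: (@eq_Ck_on R _ _ k _
    (fun x => gram i (param i x) (lift b c) (lift a d))) => //.
  by move=> x _; rewrite !mxE.
exact: gram_smooth.
Qed.

End metric.

(* A product decomposition of P, so that the two factors of a product manifold
   play symmetric roles. *)
Record splitting (R : realType) (P M N : manifold R) := Splitting {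
  left : P -> M;
  right : P -> N;
  glue : M -> N -> P;
  lproj : {linear 'rV[R]_(dim P) -> 'rV[R]_(dim M)};
  rproj : {linear 'rV[R]_(dim P) -> 'rV[R]_(dim N)};
  linj : {linear 'rV[R]_(dim M) -> 'rV[R]_(dim P)};
  rinj : {linear 'rV[R]_(dim N) -> 'rV[R]_(dim P)};
  index2 : chart_index M -> chart_index N -> chart_index P;
  left_glue : forall p q, left (glue p q) = p;
  right_glue : forall p q, right (glue p q) = q;
  lprojK : cancel linj lproj;
  rprojK : cancel rinj rproj;
  lproj_rinj : forall v, lproj (rinj v) = 0;
  rproj_linj : forall v, rproj (linj v) = 0;
  inj_proj : forall v, linj (lproj v) + rinj (rproj v) = v;
  index2_surj : forall k, exists i j, k = index2 i j;
  chart_dom_index2 : forall i j p,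
    chart_dom (index2 i j) p <-> chart_dom i (left p) /\ chart_dom j (right p);
  chart_index2 : forall i j p,
    chart (index2 i j) p = linj (chart i (left p)) + rinj (chart j (right p));
  param_index2 : forall i j x,
    param (index2 i j) x = glue (param i (lproj x)) (param j (rproj x));
  chart_at_index2 : forall p,
    chart_at p = index2 (chart_at (left p)) (chart_at (right p))
}.

(** * Splitting of a product manifold and exchange of its factors *)

Section product_splitting.
Context {R : realType} (M N : manifold R).
Let P := product_manifold M N.

Definition row_mx_l m n : 'rV[R]_m -> 'rV[R]_(m + n) := mulmxr (row_mx 1%:M 0).
Definition row_mx_r m n : 'rV[R]_n -> 'rV[R]_(m + n) := mulmxr (row_mx 0 1%:M).

HB.instance Definition _ m n :=
  GRing.Linear.copy (@row_mx_l m n) (mulmxr (row_mx 1%:M 0)).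
HB.instance Definition _ m n :=
  GRing.Linear.copy (@row_mx_r m n) (mulmxr (row_mx 0 1%:M)).

Lemma row_mx_lE m n u : @row_mx_l m n u = row_mx u 0.
Proof. by rewrite /row_mx_l /= mul_mx_row mulmx1 mulmx0. Qed.

Lemma row_mx_rE m n u : @row_mx_r m n u = row_mx 0 u.
Proof. by rewrite /row_mx_r /= mul_mx_row mulmx1 mulmx0. Qed.

(** Transparent, so that [left], [right] and the two projections of tangent vectors compute to those
    of the product when the warped metric is unfolded. *)
Definition product_splitting : splitting P M N.
Proof.
exists (fst : P -> M) (snd : P -> N) (fun p q => (p, q))
  (@lsubmx R 1 (dim M) (dim N)) (@rsubmx R 1 (dim M) (dim N))
  (@row_mx_l (dim M) (dim N)) (@row_mx_r (dim M) (dim N)) (fun i j => (i, j)).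
- by [].
- by [].
- by move=> v /=; rewrite row_mx_lE row_mxKl.
- by move=> v /=; rewrite row_mx_rE row_mxKr.
- by move=> v /=; rewrite row_mx_rE row_mxKl.
- by move=> v /=; rewrite row_mx_lE row_mxKr.
- by move=> v /=; rewrite row_mx_lE row_mx_rE add_row_mx addr0 add0r hsubmxK.
- by move=> [i j]; exists i, j.
- by [].
- by move=> i j p /=; rewrite row_mx_lE row_mx_rE add_row_mx addr0 add0r.
- by [].
- by [].
Defined.

End product_splitting.

(** Each statement about the left factor yields its counterpart for the right one; the case of the
    second manifold is obtained in this way. *)
Definition splitting_sym (R : realType) (P M N : manifold R)
  (S : splitting P M N) : splitting P N M.
Proof.
exists (right S) (left S) (fun q p => glue S p q) (rproj S) (lproj S) (rinj S)
  (linj S) (fun j i => index2 S i j).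
- by move=> q p; exact: right_glue.
- by move=> q p; exact: left_glue.
- exact: rprojK.
- exact: lprojK.
- exact: rproj_linj.
- exact: lproj_rinj.
- by move=> v; rewrite addrC inj_proj.
- by move=> k; have [i [j ->]] := index2_surj S k; exists j, i.
- by move=> j i p; split=> [/chart_dom_index2[]//|[jp ip]]; apply/chart_dom_index2.
- by move=> j i p; rewrite chart_index2 addrC.
- by move=> j i x; rewrite param_index2.
- exact: chart_at_index2.
Defined.

(** * Differentials of maps factoring through a projection *)

Section lift.
Context {R : realType} {P M N : manifold R} (S : splitting P M N).
Implicit Types (i : chart_index M) (j : chart_index N) (p : P).

Lemma lproj_chart i j p : lproj S (chart (index2 S i j) p) = chart i (left S p).
Proof. by rewrite chart_index2 linearD lprojK lproj_rinj addr0. Qed.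

Lemma param_left (W : Type) (F : M -> W) i j :
  (F \o left S) \o param (index2 S i j) = (F \o param i) \o lproj S.
Proof. by apply/funext => x /=; rewrite param_index2 left_glue. Qed.

(** In a product chart, [F \o left S] reads as [F \o param i] after the linear map [lproj S], which
    is its own differential. *)
Lemma diff_left (W : normedModType R) (F : M -> W) i j p u :
  differentiable (F \o param i) (chart i (left S p)) ->
  'd ((F \o left S) \o param (index2 S i j)) (chart (index2 S i j) p) u =
  'd (F \o param i) (chart i (left S p)) (lproj S u).
Proof.
move=> dF; have cL := @linear_rV_continuous _ _ _ (lproj S).
have dF' : differentiable (F \o param i) (lproj S (chart (index2 S i j) p)).
  by rewrite lproj_chart.
apply: etrans (congr1 (fun h => 'd h (chart (index2 S i j) p) u)
  (param_left F i j)) _.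
apply: etrans (congr1 (@^~ u) (diff_comp (linear_differentiable _ cL) dF')) _.
apply: etrans (congr1 (fun y => 'd (F \o param i) y
  ('d (lproj S) (chart (index2 S i j) p) u)) (lproj_chart i j p)) _.
exact: (congr1 (fun h => 'd (F \o param i) (chart i (left S p)) (h u))
  (diff_lin _ cL)).
Qed.

Lemma dfun_left (f : M -> R) p v : smooth_fun f ->
  dfun (fun q => f (left S q)) p v = dfun f (left S p) (lproj S v).
Proof.
move=> sf; rewrite /dfun (chart_at_index2 S).
by apply: diff_left; exact: smooth_fun_differentiable sf (chart_atP _).
Qed.

Lemma dmap_left p v : dmap (left S) p v = lproj S v.
Proof.
rewrite /dmap (chart_at_index2 S).
have cp := chart_atP (left S p).
apply: etrans (diff_left _ _ (transition_differentiable cp cp)) _.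
exact: diff_chart_param.
Qed.

(** Transition maps of product charts act factor by factor. The proof differentiates
    [chart i \o left S], read in the chart at [p], in two ways. *)
Lemma lproj_components i j p v : chart_dom (index2 S i j) p ->
  lproj S (components (index2 S i j) p v) = components i (left S p) (lproj S v).
Proof.
move=> ijp; have [ip jp] := (chart_dom_index2 S i j p).1 ijp.
have cL := @linear_rV_continuous _ _ _ (lproj S).
have cp := chart_atP p; have dt := transition_differentiable cp ijp.
have E : lproj S \o (chart (index2 S i j) \o param (chart_at p)) =
    (chart i \o left S) \o param (chart_at p).
  by apply/funext => x /=; rewrite lproj_chart.
have E1 := congr1 (@^~ v) (diff_comp dt (linear_differentiable _ cL)).
have E2 := congr1 (fun h => h ('d (chart (index2 S i j) \o param (chart_at p))
  (chart (chart_at p) p) v)) (diff_lin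
    ((chart (index2 S i j) \o param (chart_at p)) (chart (chart_at p) p)) cL).
apply: etrans (esym E2) _; apply: etrans (esym E1) _.
apply: etrans (congr1 (fun h => 'd h (chart (chart_at p) p) v) E) _.
rewrite (chart_at_index2 S); apply: diff_left.
exact: transition_differentiable (chart_atP _) ip.
Qed.

Lemma lproj_chart_img i j x :
  (chart (index2 S i j) @` chart_dom (index2 S i j)) x ->
  (chart i @` chart_dom i) (lproj S x).
Proof.
move=> [p /chart_dom_index2[ip _] <-]; rewrite lproj_chart.
exact: chart_img.
Qed.

Lemma smooth_fun_left (f : M -> R) : smooth_fun f -> smooth_fun (fun p => f (left S p)).
Proof.
move=> sf k n; have [i [j ->]] := index2_surj S k.
rewrite [X in Ck_on _ _ X](param_left f i j).
apply: Ck_on_sub (@lproj_chart_img i j) _.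
apply: Ck_on_compr (sf i n); first exact: chart_img_open.
exact: linear_rV_continuous.
Qed.

End lift.

(** * Horizontal lifts and restriction of vector fields to a slice *)

Section slice.
Context {R : realType} {P M N : manifold R} (S : splitting P M N).
Implicit Types (i : chart_index M) (j : chart_index N).

Lemma rproj_components i j p v : chart_dom (index2 S i j) p ->
  rproj S (components (index2 S i j) p v) = components j (right S p) (rproj S v).
Proof. exact: (@lproj_components _ _ _ _ (splitting_sym S) j i). Qed.

Definition lift (X : vfield M) : vfield P := fun p => linj S (X (left S p)).

Lemma smooth_lift X : smooth_vfield X -> smooth_vfield (lift X).
Proof.
move=> sX k n; have [i [j ->]] := index2_surj S k.
pose F x := components i (param i x) (X (param i x)).
apply: (@eq_Ck_on R _ _ n _ ((linj S \o F) \o lproj S)).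
- exact: chart_img_open.
(* The components of the lift are split into their two blocks; the block along [N] is zero. *)
- move=> x ijx; rewrite /= -[RHS](inj_proj S).
  have ijp := param_chart_dom ijx.
  rewrite lproj_components// rproj_components// /lift lprojK rproj_linj.
  by rewrite components0 linear0 addr0 param_index2 left_glue.
- apply: Ck_on_sub (@lproj_chart_img _ _ _ _ S i j) _.
  apply: Ck_on_compr; [exact: chart_img_open|exact: linear_rV_continuous|].
  apply: Ck_on_compl (sX i n); first exact: chart_img_open.
  exact: linear_rV_continuous.
Qed.

Variable q : N.
Implicit Type Z : vfield P.

Let slice_chart (x : 'rV[R]_(dim M)) : 'rV[R]_(dim P) :=
  linj S x + rinj S (chart (chart_at q) q).

Let slice_chart_img i x : (chart i @` chart_dom i) x ->
  (chart (index2 S i (chart_at q)) @` chart_dom (index2 S i (chart_at q)))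
    (slice_chart x).
Proof.
move=> [p ip <-]; exists (glue S p q).
  by apply/chart_dom_index2; rewrite left_glue right_glue; split=> //; exact: chart_atP.
by rewrite chart_index2 left_glue right_glue.
Qed.

Let param_slice i x :
  param (index2 S i (chart_at q)) (slice_chart x) = glue S (param i x) q.
Proof.
rewrite param_index2 /slice_chart !linearD lprojK lproj_rinj rproj_linj rprojK.
by rewrite addr0 add0r chartK//; exact: chart_atP.
Qed.

(** Read in charts, restriction to the slice is composition with the affine map [slice_chart]. A
    general [L] covers both [lproj S] and a linear form applied after [rproj S]. *)
Lemma Ck_on_slice Z i (W : normedModType R) (L : {linear 'rV[R]_(dim P) -> W}) n :
  smooth_vfield Z ->
  Ck_on n (chart i @` chart_dom i) (fun x =>
    L (components (index2 S i (chart_at q)) (glue S (param i x) q)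
      (Z (glue S (param i x) q)))).
Proof.
move=> sZ; set k := index2 S i (chart_at q).
have := Ck_on_affine (rinj S (chart (chart_at q) q)) (chart_img_open k)
  (@linear_rV_continuous _ _ _ (linj S)) (sZ k n).
move=> /(Ck_on_sub (@slice_chart_img i)) H.
apply: eq_Ck_on (Ck_on_compl (chart_img_open i) (@linear_rV_continuous _ _ _ L) H).
  exact: chart_img_open.
by move=> x _; rewrite /= -/(slice_chart x) param_slice.
Qed.

Lemma glue_dom i x : (chart i @` chart_dom i) x ->
  chart_dom (index2 S i (chart_at q)) (glue S (param i x) q).
Proof. by move=> /slice_chart_img/param_chart_dom; rewrite param_slice. Qed.

Lemma smooth_lproj_slice Z : smooth_vfield Z ->
  smooth_vfield (fun p => lproj S (Z (glue S p q))).
Proof.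
move=> sZ i n; apply: eq_Ck_on (@Ck_on_slice Z i _ (lproj S) n sZ).
  exact: chart_img_open.
move=> x /glue_dom ix; apply: etrans (lproj_components _ ix) _.
exact: (congr1 (fun p => components i p _) (left_glue S _ q)).
Qed.

Lemma smooth_dfun_slice Z (h : N -> R) : smooth_vfield Z ->
  smooth_fun (fun p => dfun h q (rproj S (Z (glue S p q)))).
Proof.
move=> sZ i n.
(* As [q] is fixed, [dfun h q] is one linear form independent of the point of the slice; it is
   expressed in the chart [chart_at q], where components of a vector at [q] are the vector
   itself. *)
pose D : {linear 'rV[R]_(dim N) -> R^o} :=
  'd (h \o param (chart_at q)) (chart (chart_at q) q).
apply: eq_Ck_on (@Ck_on_slice Z i R^o (D \o rproj S) n sZ).
  exact: chart_img_open.
move=> x /glue_dom ix; apply: (congr1 D); apply: etrans (rproj_components _ ix) _.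
apply: etrans (congr1 (fun r => components (chart_at q) r _) (right_glue S _ q)) _.
exact: components_chart_at.
Qed.

End slice.

(** * Connections projected onto a slice and their conjugacy *)

Section slice_connection.
Context {R : realType} {P M N : manifold R} (S : splitting P M N).
Context {gM : form2 M} {gN : form2 N} {fM : M -> R} {fN : N -> R} (c : R).
Hypotheses (gM_metric : riemannian_metric gM) (gN_metric : riemannian_metric gN).
Hypotheses (fM_smooth : smooth_fun fM) (fN_smooth : smooth_fun fN).
Hypothesis fN_gt0 : forall q, 0 < fN q.
Variable G : form2 P.
Hypothesis GE : forall p v w, G p v w =
  fN (right S p) ^+ 2 * gM (left S p) (lproj S v) (lproj S w)
  + fM (left S p) ^+ 2 * gN (right S p) (rproj S v) (rproj S w)
  + c * fM (left S p) * fN (right S p) *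
    (dfun fM (left S p) (lproj S v) * dfun fN (right S p) (rproj S w)
     + dfun fN (right S p) (rproj S v) * dfun fM (left S p) (lproj S w)).
Variable q : N.

(* The G-orthogonal projection, at the points of the slice through q, onto the
   tangent space of M. *)
Definition tangential (p : M) (w : 'rV[R]_(dim P)) : 'rV[R]_(dim M) :=
  lproj S w + (c * fM p / fN q * dfun fN q (rproj S w)) *: grad gM fM p.

Lemma tangentialD p v w : tangential p (v + w) = tangential p v + tangential p w.
Proof.
by rewrite /tangential !linearD dfunD mulrDr scalerDl addrACA.
Qed.

Lemma tangentialZ p a w : tangential p (a *: w) = a *: tangential p w.
Proof.
by rewrite /tangential !linearZ dfunZ scalerDr scalerA mulrCA.
Qed.

Lemma tangential_linj p v : tangential p (linj S v) = v.
Proof. by rewrite /tangential lprojK rproj_linj dfun0 mulr0 scale0r addr0. Qed.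

(** Against a horizontal vector the [gN] term and half of the cross term vanish. In the remaining
    half [dfun fM] is the pairing with the gradient, and factoring out [fN q ^+ 2] leaves the
    coefficient [c * fM p / fN q]. *)
Lemma tangentialP p v w :
  G (glue S p q) w (linj S v) = fN q ^+ 2 * gM p (tangential p w) v.
Proof.
rewrite GE left_glue right_glue lprojK rproj_linj.
rewrite (Defs.metric_sym gN_metric) (metric0l gN_metric) dfun0.
rewrite /tangential (metricDl gM_metric) (metricZl gM_metric).
rewrite (grad_spec gM_metric).
have := fN_gt0 q; move: (fN q) => a a0.
by field; rewrite gt_eqF.
Qed.

Lemma split_metric_sym p v w : G p v w = G p w v.
Proof.
rewrite !GE (Defs.metric_sym gM_metric _ (lproj S w)).
by rewrite (Defs.metric_sym gN_metric _ (rproj S w)); ring.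
Qed.

Definition slice_connection (D : vfield P -> vfield P -> vfield P) :
    vfield M -> vfield M -> vfield M :=
  fun X Y p => tangential p (D (lift S X) (lift S Y) (glue S p q)).

Lemma liftD X Y : lift S (fun p => X p + Y p) = (fun p => lift S X p + lift S Y p).
Proof. by apply/funext => p; rewrite /lift linearD. Qed.

Lemma liftZ (f : M -> R) X :
  lift S (fun p => f p *: X p) = (fun p => f (left S p) *: lift S X p).
Proof. by apply/funext => p; rewrite /lift linearZ. Qed.

(** The axioms pass through because [tangential] is linear on each fibre. For the Leibniz rule, [f]
    is lifted to [f] after [left S], whose derivative along [lift S X] is that of [f] along [X], and
    [tangential_linj] returns [Y] from its lift. *)
Lemma slice_connection_affine D : affine_connection D ->
  affine_connection (slice_connection D).
Proof.
move=> DP; split.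
- move=> X Y sX sY.
  have sD := connection_smooth DP (smooth_lift S sX) (smooth_lift S sY).
  apply: smooth_vfieldD; first exact: smooth_lproj_slice.
  apply: smooth_vfieldZ; last exact: grad_smooth.
  apply: smooth_funM; last exact: smooth_dfun_slice.
  have cst_smooth a : smooth_fun (fun _ : M => a : R) by move=> i k; exact: Ck_on_cst.
  by apply: smooth_funM => //; exact: smooth_funM.
- move=> X X' Y /(smooth_lift S) sX /(smooth_lift S) sX' /(smooth_lift S) sY p.
  by rewrite /slice_connection liftD (connection_addl DP)// tangentialD.
- move=> f X Y sf /(smooth_lift S) sX /(smooth_lift S) sY p.
  rewrite /slice_connection liftZ (connection_scalel DP)//.
    by rewrite tangentialZ left_glue.
  exact: smooth_fun_left.
- move=> X Y Y' /(smooth_lift S) sX /(smooth_lift S) sY /(smooth_lift S) sY' p.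
  by rewrite /slice_connection liftD (connection_addr DP)// tangentialD.
- move=> f X Y sf sX sY p.
  rewrite /slice_connection liftZ (connection_leibniz DP);
    [|exact: smooth_fun_left|exact: smooth_lift|exact: smooth_lift].
  rewrite tangentialD !tangentialZ dfun_left// left_glue.
  by rewrite /lift lprojK left_glue tangential_linj.
Qed.

Lemma slice_connection_conjugate D Ds : conjugate G D Ds ->
  conjugate gM (slice_connection D) (slice_connection Ds).
Proof.
move=> DDs X Y Z sX sY sZ p.
have := DDs _ _ _ (smooth_lift S sX) (smooth_lift S sY) (smooth_lift S sZ) (glue S p q).
have lE W : lift S W (glue S p q) = linj S (W p) by rewrite /lift left_glue.
(* Symmetry brings the lifted field of the last term into the second slot, so that [tangentialP]
   applies to both terms. *)
rewrite [X in _ = _ + X -> _]split_metric_sym !lE !tangentialP.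
have sg := metric_smooth_fun gM_metric sY sZ.
have sN := smooth_funM fN_smooth fN_smooth.
(* On lifts [G] is a product of a function on [N] and a function on [M]; the square is written as a
   product to suit [dfunM]. *)
have -> : (fun p => G p (lift S Y p) (lift S Z p)) =
    (fun p => fN (right S p) * fN (right S p) *
              gM (left S p) (Y (left S p)) (Z (left S p))).
  apply/funext => r; rewrite GE /lift !lprojK !rproj_linj !dfun0.
  by rewrite (metric0l gN_metric); ring.
rewrite dfunM; [|exact: (smooth_fun_left (splitting_sym S) sN)
  |exact: (smooth_fun_left S sg)].
rewrite (dfun_left S _ _ sg) (dfun_left (splitting_sym S) _ _ sN) /=.
(* The derivative of the factor on [N] along a horizontal vector is zero, so all terms carry the
   constant [fN q ^+ 2], which is then cancelled. *)
rewrite left_glue right_glue lprojK rproj_linj dfun0 mulr0 addr0 -expr2 -mulrDr.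
have fN0 : fN q ^+ 2 != 0 by rewrite expf_neq0// gt_eqF.
move=> /(mulfI fN0) ->; congr (_ + _).
exact: Defs.metric_sym.
Qed.

End slice_connection.

Lemma slice_dualistic_structure (R : realType) (P M N : manifold R)
  (S : splitting P M N) (gM : form2 M) (gN : form2 N) (fM : M -> R) (fN : N -> R)
  (c : R) (G : form2 P) (D Ds : vfield P -> vfield P -> vfield P) :
  riemannian_metric gM -> riemannian_metric gN ->
  smooth_fun fM -> smooth_fun fN -> (forall q, 0 < fN q) ->
  (forall p v w, G p v w =
    fN (right S p) ^+ 2 * gM (left S p) (lproj S v) (lproj S w)
    + fM (left S p) ^+ 2 * gN (right S p) (rproj S v) (rproj S w)
    + c * fM (left S p) * fN (right S p) *
      (dfun fM (left S p) (lproj S v) * dfun fN (right S p) (rproj S w)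
       + dfun fN (right S p) (rproj S v) * dfun fM (left S p) (lproj S w))) ->
  dualistic_structure G D Ds ->
  exists nabla nablas : vfield M -> vfield M -> vfield M,
    dualistic_structure gM nabla nablas.
Proof.
move=> gMP gNP sM sN fN0 GE [DP DsP DDs].
(* Any slice will do; one exists since [N] is nonempty. *)
have [q _] := manifold_nonempty N.
exists (slice_connection S (gM := gM) (fM := fM) (fN := fN) c q D).
exists (slice_connection S (gM := gM) (fM := fM) (fN := fN) c q Ds).
split.
- exact (slice_connection_affine S c gMP sM q DP).
- exact (slice_connection_affine S c gMP sM q DsP).
- exact (slice_connection_conjugate gMP gNP sN fN0 GE q DDs).
Qed.

(** * The warped metric in split form, and both factors *)

Lemma warped_metricE (R : realType) (M1 M2 : manifold R) (g1 : form2 M1)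
  (g2 : form2 M2) (f1 : M1 -> R) (f2 : M2 -> R) (c : R)
  (S := product_splitting M1 M2) p v w :
  smooth_fun f1 -> smooth_fun f2 ->
  warped_metric g1 g2 f1 f2 c p v w =
  f2 (right S p) ^+ 2 * g1 (left S p) (lproj S v) (lproj S w)
  + f1 (left S p) ^+ 2 * g2 (right S p) (rproj S v) (rproj S w)
  + c * f1 (left S p) * f2 (right S p) *
    (dfun f1 (left S p) (lproj S v) * dfun f2 (right S p) (rproj S w)
     + dfun f2 (right S p) (rproj S v) * dfun f1 (left S p) (lproj S w)).
Proof.
move=> s1 s2.
have E1 u : dfun (hlift f1) p u = dfun f1 (left S p) (lproj S u).
  exact: (dfun_left S).
have E2 u : dfun (vlift f2) p u = dfun f2 (right S p) (rproj S u).
  exact: (dfun_left (splitting_sym S)).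
have E3 u : dmap (fst : product_manifold M1 M2 -> M1) p u = lproj S u.
  exact: (dmap_left S).
have E4 u : dmap (snd : product_manifold M1 M2 -> M2) p u = rproj S u.
  exact: (dmap_left (splitting_sym S)).
by rewrite /warped_metric /pullback !E1 !E2 !E3 !E4.
Qed.

Theorem proposition2 (R : realType) (M1 M2 : manifold R)
  (g1 : form2 M1) (g2 : form2 M2) (f1 : M1 -> R) (f2 : M2 -> R) (c : R)
  (g1_metric : riemannian_metric g1) (g2_metric : riemannian_metric g2)
  (f1_smooth : smooth_fun f1) (f2_smooth : smooth_fun f2)
  (f1_gt0 : forall p, 0 < f1 p) (f2_gt0 : forall p, 0 < f2 p)
  (c_bound : forall p1 p2,
     0 <= c ^+ 2 * g1 p1 (grad g1 f1 p1) (grad g1 f1 p1)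
                 * g2 p2 (grad g2 f2 p2) (grad g2 f2 p2) < 1)
  (nabla nablas : vfield (product_manifold M1 M2) ->
     vfield (product_manifold M1 M2) -> vfield (product_manifold M1 M2))
  (dual : dualistic_structure (warped_metric g1 g2 f1 f2 c) nabla nablas) :
  (exists nabla1 nabla1s : vfield M1 -> vfield M1 -> vfield M1,
     dualistic_structure g1 nabla1 nabla1s) /\
  (exists nabla2 nabla2s : vfield M2 -> vfield M2 -> vfield M2,
     dualistic_structure g2 nabla2 nabla2s).
Proof.
split.
- apply: (slice_dualistic_structure (S := product_splitting M1 M2)
    g1_metric g2_metric f1_smooth f2_smooth f2_gt0 _ dual) => p v w.
  exact: warped_metricE.
(* The formula for the metric is invariant under exchange of the factors, up to the order of sums
   and products. *)
- apply: (slice_dualistic_structure (S := splitting_sym (product_splitting M1 M2))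
    (c := c) g2_metric g1_metric f2_smooth f1_smooth f1_gt0 _ dual) => p v w.
  by rewrite (warped_metricE _ _ _ _ _ _ f1_smooth f2_smooth) /=; ring.
Qed.
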